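(* Let $p$ be a prime, $q=p^e$, $m,k\ge1$, and let $f\in\mathbb{F}_{q^m}[x_1,\dots,x_k]$ be a polynomial of degree $d\ge1$. Then \[\nu_p\big(N(f=y^q-y)\big)\ge\Big\lceil\frac{em(q-1)}{q^m-1}\Big\lceil\frac{k(q^m-1)}{d(q-1)}\Big\rceil\Big\rceil.\]
   Context: $N(f=y^q-y)$ denotes the number of $(x_1,\dots,x_k,y)\in\mathbb{F}_{q^m}^{k+1}$ with $f(x_1,\dots,x_k)=y^q-y$; $\nu_p$ is the $p$-adic valuation. *)

(* Defs.v *)
From HB Require Import structures.
From mathcomp Require Import all_boot all_order all_algebra all_field.
From mathcomp Require Import mpoly.
Set Implicit Arguments. Unset Strict Implicit. Unset Printing Implicit Defensive.

Definition ceil_div (a b : nat) : nat := ((a + b.-1) %/ b)%N.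

Definition Ncount (F : finFieldType) (k q : nat) (f : {mpoly F[k]}) : nat :=
  #|[set xy : {ffun 'I_k -> F} * F | (f.@[xy.1] == xy.2 ^+ q - xy.2)%R]|.
Arguments Ncount {F} k q f.

(* Main.v *)
Require Import Defs.
From HB Require Import structures.
From mathcomp Require Import all_boot all_order all_algebra all_field.
From mathcomp Require Import mpoly.
From mathcomp Require Import cyclic zify ring.
Set Implicit Arguments. Unset Strict Implicit. Unset Printing Implicit Defensive.
Import Order.TTheory GRing.Theory Num.Theory.
Local Open Scope ring_scope.

(* Write Q = q^m and h = em.  Orthogonality of the characters psi(u) = zeta^(Tr u)
   gives N = sum_(c in F_q) sum_x psi(c f(x)).  On F, (Q - 1) psi is a polynomial of
   degree < Q in the Teichmuller character T, whose j-th coefficient is essentially a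
   Gauss sum and hence divisible by pi^(s_p(j)), pi = zeta - 1 (Stickelberger).
   Expanding over the monomials of f, a choice of exponents J contributes only if
   q - 1 divides sum J and Q - 1 divides every exponent of T(x_i); this remains true
   after each of the h cyclic rotations of the base-p digits of J, and averaging the
   resulting degree bounds over the rotations bounds the total digit sum of J.  As
   p is a unit times pi^(p-1), the pi-divisibility of the integer N is a
   p-divisibility.  All computations take place in Z[w], w a complex root of unity of
   order p(Q - 1), localized at the kernel of a specialization Z[w] -> F: this exists
   because Phi_(p(Q-1)) vanishes at every generator of the group of units of F. *)

(** * Reduction of cyclotomic integers to a finite field *)

Definition int_eval (R : nzRingType) (P : {poly int}) (x : R) : R :=
  (map_poly intr P).[x].

Section Specialization.
Variables (K L : fieldType).

Section Closure.
Variables (w : K) (theta : L).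

(* x lies in Z[w] and reduces to a under the specialization w |-> theta. *)
Definition red (x : K) (a : L) : Prop :=
  exists2 P : {poly int}, x = int_eval P w & a = int_eval P theta.

Lemma redD x a y b : red x a -> red y b -> red (x + y) (a + b).
Proof.
by move=> [P -> ->] [P' -> ->]; exists (P + P'); rewrite /int_eval rmorphD hornerD.
Qed.

Lemma redM x a y b : red x a -> red y b -> red (x * y) (a * b).
Proof.
by move=> [P -> ->] [P' -> ->]; exists (P * P'); rewrite /int_eval rmorphM hornerM.
Qed.

Lemma red_int n : red n%:~R n%:~R.
Proof. by exists n%:P; rewrite /int_eval map_polyC hornerC. Qed.

Lemma red0 : red 0 0. Proof. exact: (red_int 0). Qed.
Lemma red1 : red 1 1. Proof. exact: (red_int 1). Qed.

Lemma red_nat n : red n%:R n%:R.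
Proof. by rewrite !pmulrn; exact: (red_int n). Qed.

Lemma redN x a : red x a -> red (- x) (- a).
Proof.
by move=> [P -> ->]; exists (- P); rewrite /int_eval rmorphN hornerN.
Qed.

Lemma redB x a y b : red x a -> red y b -> red (x - y) (a - b).
Proof. by move=> rx ry; apply: redD => //; apply: redN. Qed.

Lemma redX x a n : red x a -> red (x ^+ n) (a ^+ n).
Proof.
by move=> rx; elim: n => [|n IH]; rewrite ?exprS; [apply: red1 | apply: redM].
Qed.

Lemma red_gen : red w theta.
Proof. by exists 'X; rewrite /int_eval map_polyX hornerX. Qed.

Lemma red_sum I (r : seq I) (P : pred I) (X : I -> K) (A : I -> L) :
  (forall i, P i -> red (X i) (A i)) ->
  red (\sum_(i <- r | P i) X i) (\sum_(i <- r | P i) A i).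
Proof. by move=> h; apply: (big_ind2 red) => //; [apply: red0 | move=> *; apply: redD]. Qed.

Lemma red_prod I (r : seq I) (P : pred I) (X : I -> K) (A : I -> L) :
  (forall i, P i -> red (X i) (A i)) ->
  red (\prod_(i <- r | P i) X i) (\prod_(i <- r | P i) A i).
Proof. by move=> h; apply: (big_ind2 red) => //; [apply: red1 | move=> *; apply: redM]. Qed.

End Closure.
End Specialization.

Lemma expf_card_pred (F : finFieldType) (u : F) : u != 0 -> u ^+ #|F|.-1 = 1.
Proof.
move=> u0; apply: (mulfI u0).
by rewrite mulr1 -exprS prednK ?expf_card // ltnW // finNzRing_gt1.
Qed.

Lemma finField_prim_root (F : finFieldType) :
  exists t : F, #|F|.-1.-primitive_root t.
Proof.
have h1 := finNzRing_gt1 F.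
pose rs := enum [pred x : F | x != 0].
have : has #|F|.-1.-primitive_root rs.
  apply: has_prim_root; first by rewrite -ltnS prednK // ltnW.
  - apply/allP => x; rewrite mem_enum unity_rootE => x0.
    by apply/eqP/expf_card_pred.
  - by rewrite /rs enum_uniq.
  - by rewrite -cardE (cardC1 (0 : F)).
by case/hasP => t _ ht; exists t.
Qed.

(** The quotient of X^(pn) - 1 by X^n - 1 takes the value p = 0 at t, and it is the product of the
    Phi_d with d dividing pn but not n. Some such Phi_d vanishes at t; then t^d = 1 forces n to
    divide d, and d / n is a divisor of p other than 1. *)
Lemma Cyclotomic_prim_root_char (p n : nat) (F : fieldType) (t : F) :
  p \in [pchar F] -> (0 < n)%N -> n.-primitive_root t ->
  int_eval 'Phi_(p * n) t = 0.
Proof.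
move=> cp n0 ht; have pp := pcharf_prime cp; have p0 := prime_gt0 pp.
pose ev (P : {poly int}) := int_eval P t.
have evM P S : ev (P * S) = ev P * ev S by rewrite /ev /int_eval rmorphM hornerM.
have evXn k : ev ('X^k - 1) = t ^+ k - 1.
  by rewrite /ev /int_eval rmorphB /= map_polyXn rmorph1 !hornerE.
have ev_prod I (r : seq I) (P : pred I) (X : I -> {poly int}) :
  ev (\prod_(i <- r | P i) X i) = \prod_(i <- r | P i) ev (X i).
  by apply: (big_morph ev evM); rewrite /ev /int_eval rmorph1 hornerC.
have e0 : ev (\sum_(i < p) 'X^(n * i)) = 0.
  rewrite /ev /int_eval rmorph_sum horner_sum.
  rewrite (eq_bigr (fun _ => 1)) => [|i _]; last first.
    by rewrite /= map_polyXn hornerXn exprM (prim_expr_order ht) expr1n.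
  by rewrite sumr_const card_ord (pcharf0 cp).
have fac : 'X^(p * n) - 1 = ('X^n - 1) * \sum_(i < p) 'X^(n * i) :> {poly int}.
  rewrite mulnC exprM subrX1; congr (_ * _).
  by apply: eq_bigr => i _; rewrite exprM.
have pn0 : (0 < p * n)%N by rewrite muln_gt0 p0.
have dn : (n %| p * n)%N by rewrite dvdn_mull.
have := prod_Cyclotomic pn0; rewrite fac.
rewrite (bigID (fun d => d %| n)%N) /=.
have -> : \prod_(i <- divisors (p * n) | (i %| n)%N) 'Phi_i = 'X^n - 1.
  rewrite -(prod_Cyclotomic n0) -big_filter; apply: perm_big.
  apply: uniq_perm; rewrite ?filter_uniq ?divisors_uniq // => d.
  rewrite mem_filter -!dvdn_divisors //; case dn': (d %| n)%N => //=.
  exact: dvdn_trans dn' dn.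
move/mulfI => /(_ (monic_neq0 (monicXnsubC _ n0))) /(congr1 ev).
rewrite e0 ev_prod => /eqP; rewrite prodf_seq_eq0 => /hasP[d].
rewrite -dvdn_divisors // => dpn /andP[ndn /eqP ed].
have d0 : (0 < d)%N by apply: dvdn_gt0 dpn.
have td : t ^+ d = 1.
  apply/eqP; rewrite -subr_eq0 -evXn -(prod_Cyclotomic d0) ev_prod.
  rewrite prodf_seq_eq0; apply/hasP; exists d; last by rewrite ed eqxx.
  by rewrite -dvdn_divisors.
have nd : (n %| d)%N by rewrite (prim_order_dvd ht) td.
case/dvdnP: nd ndn dpn ed => c ->; rewrite dvdn_pmul2r // => ndn /prime_nt_dvdP -> //.
by apply: contra ndn => /eqP ->; rewrite mul1n.
Qed.

(** Phi_n is monic and is the minimal polynomial of w, so division with remainder over the integers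
    shows that it generates the kernel of evaluation at w. Hence w |-> t is well defined on Z[w]. *)
Lemma int_eval_ker (n : nat) (w : algC) (F : fieldType) (t : F) :
  n.-primitive_root w -> int_eval 'Phi_n t = 0 ->
  forall P, int_eval P w = 0 -> int_eval P t = 0.
Proof.
move=> hw ht P.
have mn := Cyclotomic_monic n.
have Pq := Pdiv.RingMonic.rdivp_eq mn P.
set q := Pdiv.Ring.rdivp _ _ in Pq; set r := Pdiv.Ring.rmodp _ _ in Pq.
have w0 : int_eval 'Phi_n w = 0.
  apply/rootP; rewrite (Cintr_Cyclotomic hw) -(minCpoly_cyclotomic hw).
  exact: root_minCpoly.
have evD (R : fieldType) (x : R) : int_eval P x =
    int_eval q x * int_eval 'Phi_n x + int_eval r x.
  by rewrite Pq /int_eval rmorphD rmorphM hornerD hornerM.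
rewrite !evD w0 ht !mulr0 !add0r => rw.
suff -> : r = 0 by rewrite /int_eval rmorph0 horner0.
apply/eqP/negPn/negP => r0.
have rt : root (map_poly (intr : int -> algC) r) w by apply/rootP.
have [pq [pqE _] /(_ (map_poly intr r))] := minCpolyP w.
have -> : map_poly ratr (map_poly intr r) = map_poly (intr : int -> algC) r.
  by rewrite -map_poly_comp; apply: eq_map_poly => x /=; rewrite ratr_int.
have szr : size (map_poly (intr : int -> rat) r) = size r.
  by rewrite size_map_inj_poly //; exact: intr_inj.
rewrite rt => /esym /dvdp_leq; rewrite -size_poly_eq0 szr size_poly_eq0 => /(_ r0).
have -> : size pq = size 'Phi_n.
  have := congr1 (fun q : {poly algC} => size q) pqE.
  rewrite (minCpoly_cyclotomic hw) -(Cintr_Cyclotomic hw) size_map_poly => <-.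
  by rewrite size_map_inj_poly //; exact: intr_inj.
by rewrite leqNgt Pdiv.Ring.ltn_rmodp monic_neq0.
Qed.

(** * Divisibility by powers of pi *)

Section Valuation.
Variables (K L : fieldType) (w : K) (t : L).
Hypothesis ker : forall P, int_eval P w = 0 -> int_eval P t = 0.
Variables (p : nat) (zeta : K).
Hypotheses (pL : p \in [pchar L]) (zetaP : p.-primitive_root zeta).
Hypothesis red_zeta : red w t zeta 1.
Local Notation red := (red w t).
Local Notation pi := (zeta - 1).

Let p_prime : prime p := pcharf_prime pL.

(** The kernel hypothesis makes the relation [red] single-valued. *)
Lemma red_inj x a b : red x a -> red x b -> a = b.
Proof.
move=> [P -> ->] [S /eqP]; rewrite -subr_eq0 => /eqP PS ->.
apply/eqP; rewrite -subr_eq0; apply/eqP.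
have -> : int_eval P t - int_eval S t = int_eval (P - S) t.
  by rewrite /int_eval rmorphB hornerD hornerN.
by apply: ker; rewrite /int_eval rmorphB hornerD hornerN.
Qed.

(* Divisibility by pi^n in the localization of Z[w] at the kernel of w |-> t. *)
Definition pi_dvd (n : nat) (x : K) : Prop :=
  exists s b y c, [/\ red s b, b != 0, red y c & s * x = pi ^+ n * y].

Lemma red_pi : red pi 0.
Proof. by rewrite -(subrr 1); apply: redB => //; apply: red1. Qed.

Lemma pi_neq0 : pi != 0.
Proof.
rewrite subr_eq0; apply/eqP => z1; move: (prim_order_dvd zetaP 1).
rewrite z1 expr1n eqxx dvdn1 => /eqP p1; by move: p_prime; rewrite p1.
Qed.

Lemma pi_dvd_red x a : red x a -> pi_dvd 0 x.
Proof.
by move=> rx; exists 1, 1, x, a; split; rewrite ?oner_eq0 //; apply: red1.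
Qed.

Lemma pi_dvd0 n : pi_dvd n 0.
Proof.
by exists 1, 1, 0, 0; split; rewrite ?oner_eq0 ?mulr0 //; [apply: red1 | apply: red0].
Qed.

Lemma pi_dvdD n x y : pi_dvd n x -> pi_dvd n y -> pi_dvd n (x + y).
Proof.
move=> [s [b [u [c [rs b0 ru e]]]]] [s' [b' [u' [c' [rs' b0' ru' e']]]]].
exists (s * s'), (b * b'), (s' * u + s * u'), (b' * c + b * c'); split.
- exact: redM.
- by rewrite mulf_neq0.
- by apply: redD; apply: redM.
have -> : s * s' * (x + y) = s' * (s * x) + s * (s' * y) by ring.
by rewrite e e'; ring.
Qed.

Lemma pi_dvdM n m x y : pi_dvd n x -> pi_dvd m y -> pi_dvd (n + m) (x * y).
Proof.
move=> [s [b [u [c [rs b0 ru e]]]]] [s' [b' [u' [c' [rs' b0' ru' e']]]]].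
exists (s * s'), (b * b'), (u * u'), (c * c'); split; rewrite ?mulf_neq0 //.
- exact: redM.
- exact: redM.
by rewrite mulrACA e e' exprD mulrACA.
Qed.

Lemma pi_dvd_le n m x : (m <= n)%N -> pi_dvd n x -> pi_dvd m x.
Proof.
move=> mn [s [b [u [c [rs b0 ru e]]]]].
exists s, b, (pi ^+ (n - m) * u), (0 ^+ (n - m) * c); split => //.
  by apply: redM => //; apply: redX; apply: red_pi.
by rewrite mulrA -exprD subnKC.
Qed.

Lemma pi_dvd_sum I (r : seq I) (P : pred I) (X : I -> K) n :
  (forall i, P i -> pi_dvd n (X i)) -> pi_dvd n (\sum_(i <- r | P i) X i).
Proof.
by move=> h; apply: big_ind => //; [apply: pi_dvd0 | apply: pi_dvdD].
Qed.

Lemma pi_dvd_prod I (r : seq I) (P : pred I) (X : I -> K) (n : I -> nat) :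
  (forall i, P i -> pi_dvd (n i) (X i)) ->
  pi_dvd (\sum_(i <- r | P i) n i) (\prod_(i <- r | P i) X i).
Proof.
move=> h; apply: (big_ind2 pi_dvd) => //; first exact/pi_dvd_red/red1.
by move=> *; apply: pi_dvdM.
Qed.

Lemma pi_dvdX n x m : pi_dvd n x -> pi_dvd (m * n) (x ^+ m).
Proof.
move=> h; elim: m => [|m IH]; first by rewrite mul0n expr0; apply/pi_dvd_red/red1.
by rewrite mulSn exprS; apply: pi_dvdM.
Qed.

Lemma pi_dvd_unitM n s b x : red s b -> b != 0 -> pi_dvd n (s * x) -> pi_dvd n x.
Proof.
move=> rs b0 [s' [b' [u [c [rs' b0' ru e]]]]].
exists (s' * s), (b' * b), u, c; split; rewrite ?mulf_neq0 -?mulrA //.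
exact: redM.
Qed.

Lemma pi_dvd_zetaX i : pi_dvd 1 (zeta ^+ i - 1).
Proof.
exists 1, 1, (\sum_(j < i) zeta ^+ j), (\sum_(j < i) 1 ^+ j).
split; rewrite ?oner_eq0 ?mul1r ?expr1 ?subrX1 //; first exact: red1.
by apply: red_sum => j _; apply: redX.
Qed.

(* [eps] is the product of the (1 - zeta^i) / (zeta - 1), which reduce to -i. *)
Lemma pi_ramified : exists eps b, [/\ red eps b, b != 0 & p%:R = eps * pi ^+ p.-1].
Proof.
have p0 := prime_gt0 p_prime.
pose E i : K := - \sum_(j < i.+1) zeta ^+ j.
exists (\prod_(i < p.-1) E i), (\prod_(i < p.-1) (- i.+1%:R)); split.
- apply: red_prod => i _; apply: redN.
  have -> : i.+1%:R = \sum_(j < i.+1) 1 ^+ j :> L.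
    by rewrite (eq_bigr (fun=> 1)) ?sumr_const ?card_ord // => j _; rewrite expr1n.
  by apply: red_sum => j _; apply: redX.
- apply/prodf_neq0 => i _; rewrite oppr_eq0 -(dvdn_pcharf pL) gtnNdvd //.
  by rewrite -ltn_predRL.
(* Cancel X - 1 in X^p - 1 = prod (X - zeta^i) and evaluate at 1: p is the product of the 1 - zeta^i
   for 0 < i < p. *)
have := factor_Xn_sub_1 zetaP; rewrite subrX1.
rewrite -[p in \prod_(0 <= i < p) _](prednK p0) big_mkord big_ord_recl expr0.
move/mulfI => /(_ (negbT (polyXsubC_eq0 _))) /(congr1 (horner^~ 1)).
rewrite horner_prod horner_sum => e.
transitivity (\prod_(i < p.-1) (1 - zeta ^+ i.+1)).
  transitivity (\sum_(i < p) (1 : K)); first by rewrite sumr_const card_ord.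
  transitivity (\sum_(i < p) ('X^i : {poly K}).[1]).
    by apply: eq_bigr => i _; rewrite hornerXn expr1n.
  by rewrite -e; apply: eq_bigr => i _; rewrite hornerXsubC.
rewrite (eq_bigr (fun i : 'I_p.-1 => E i * pi)); last first.
  by move=> i _; rewrite /E -opprB subrX1 mulNr mulrC.
by rewrite big_split prodr_const card_ord.
Qed.

Lemma pi_dvd_p : pi_dvd p.-1 p%:R.
Proof.
have [eps [b [re b0 ->]]] := pi_ramified.
exists 1, 1, eps, b; split; rewrite ?oner_eq0 ?mul1r 1?mulrC //; exact: red1.
Qed.

(** Write N = p^a u with u prime to p. If n exceeded (p - 1) a, cancelling pi^((p - 1) a) would
    leave a power of pi, so s u eps^a would reduce to 0 although each of its factors reduces to a
    nonzero element. *)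
Lemma pi_dvd_nat n (N : nat) : (0 < N)%N -> pi_dvd n N%:R ->
  (n <= p.-1 * logn p N)%N.
Proof.
move=> N0 [s [b [y [c [rs b0 ry e]]]]].
rewrite leqNgt; apply/negP => lt_n.
have [eps [d [re d0 pE]]] := pi_ramified.
set a := logn p N in lt_n.
have [u pu NE] := pfactor_coprime p_prime N0; rewrite -/a in NE.
have rl : red (s * u%:R * eps ^+ a) (b * u%:R * d ^+ a).
  by do 2?apply: redM => //; [apply: red_nat | apply: redX].
suff rr : red (s * u%:R * eps ^+ a) 0.
  have /eqP := red_inj rl rr; rewrite !mulf_eq0 (negPf b0) expf_eq0 (negPf d0) andbF.
  by rewrite orbF -(dvdn_pcharf pL) /=; apply/negP; rewrite -prime_coprime.
have -> : s * u%:R * eps ^+ a = pi ^+ (n - p.-1 * a) * y.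
  have := pi_neq0 => pi0.
  apply: (mulfI (expf_neq0 (p.-1 * a) pi0)); rewrite [RHS]mulrA -exprD subnKC 1?ltnW //.
  by rewrite -e NE natrM natrX pE exprMn -exprM; ring.
have -> : (n - p.-1 * a = (n - p.-1 * a).-1.+1)%N by rewrite prednK // subn_gt0.
rewrite exprS -mulrA -[0](mul0r (0 ^+ (n - p.-1 * a).-1 * c)).
by apply: redM; [apply: red_pi | apply: redM => //; apply: redX; apply: red_pi].
Qed.

End Valuation.

(** * The Teichmuller and additive characters *)

(** With w of order p(Q - 1) and t a generator of the units, w^p and t^p both have order Q - 1,
    since p is prime to Q - 1. T sends (t^p)^i to (w^p)^i, which reduces back to (t^p)^i, while zeta
    = w^(Q - 1) reduces to t^(Q - 1) = 1. *)
Lemma Teichmuller_exists (F : finFieldType) (p h : nat) :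
  #|F| = (p ^ h)%N -> p \in [pchar F] ->
  exists (w : algC) (t : F) (zeta : algC) (T : F -> algC),
  [/\ forall P, int_eval P w = 0 -> int_eval P t = 0,
      p.-primitive_root zeta, red w t zeta 1,
      {morph T : u v / u * v} & forall u, red w t (T u) u].
Proof.
move=> cF pF; have p0 := prime_gt0 (pcharf_prime pF).
have q1 := finNzRing_gt1 F; have q0 := ltnW q1.
have q10 : (0 < #|F|.-1)%N by rewrite -ltnS prednK.
have [t tP] := finField_prim_root F.
have n0 : (0 < p * #|F|.-1)%N by rewrite muln_gt0 p0.
have [w wP] := C_prim_root_exists n0.
have cop : coprime p #|F|.-1.
  apply: (@coprime_dvdl p #|F|); last exact: coprimenP.
  by rewrite cF dvdn_exp //; case: h cF => [|//] e; rewrite e in q1.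
pose z := w ^+ p; pose tau := t ^+ p.
have zP : #|F|.-1.-primitive_root z.
  have := exp_prim_root wP p; rewrite -{2}[p]muln1 gcdnC -/z.
  by rewrite -muln_gcdr gcdn1 muln1 mulKn.
have tauP : #|F|.-1.-primitive_root tau by rewrite prim_root_exp_coprime.
have zetaP : p.-primitive_root (w ^+ #|F|.-1).
  have := exp_prim_root wP #|F|.-1.
  by rewrite gcdnC -{3}[#|F|.-1]mul1n -muln_gcdl gcdn1 mul1n mulnK.
have nz u : u != 0 -> exists i : 'I_(#|F|.-1), tau ^+ i = u.
  move=> /expf_card_pred u1.
  by have [i ->] := prim_rootP tauP u1; exists i.
have tau0 : tau != 0 by rewrite (prim_root_eq0 tauP) -lt0n.
pose log u := odflt (Ordinal q10) [pick i : 'I_(#|F|.-1) | tau ^+ i == u].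
have logE u : u != 0 -> tau ^+ log u = u.
  rewrite /log; case: pickP => [i /eqP //|] /= nex /nz[i e].
  by have := nex i; rewrite e eqxx.
exists w, t, (w ^+ #|F|.-1), (fun u => if u == 0 then 0 else z ^+ log u); split.
- exact: int_eval_ker wP (Cyclotomic_prim_root_char pF q10 tP).
- by [].
- by rewrite -(prim_expr_order tP); apply/redX/red_gen.
- move=> u v /=.
  have [->|u0] := eqVneq u 0; first by rewrite !mul0r eqxx.
  have [->|v0] := eqVneq v 0; first by rewrite !mulr0 eqxx.
  rewrite mulf_eq0 (negPf u0) (negPf v0) /=.
  rewrite -exprD; apply/eqP; rewrite (eq_prim_root_expr zP).
  by rewrite -(eq_prim_root_expr tauP) exprD !logE ?mulf_neq0.
move=> u; have [->|u0] := eqVneq u 0; first exact: red0.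
by rewrite -{2}(logE u u0); apply/redX/redX/red_gen.
Qed.

(** The images of 0, ..., p - 1 are already p distinct roots of X^p - X; another fixed point would
    be one root too many. *)
Lemma pchar_fixed_nat (F : fieldType) (p : nat) (a : F) :
  p \in [pchar F] -> a ^+ p = a -> exists i : 'I_p, i%:R = a.
Proof.
move=> pF ap; have p1 := prime_gt1 (pcharf_prime pF).
suff /existsP[i /eqP e] : [exists i : 'I_p, i%:R == a] by exists i.
apply: contraT => /existsPn nE.
pose P : {poly F} := 'X^p - 'X.
have sP : size P = p.+1.
  by rewrite /P size_polyDl ?size_polyXn // size_polyN size_polyX.
have P0 : P != 0 by rewrite -size_poly_eq0 sP.
pose rs := a :: [seq i%:R | i : 'I_p].
have rootE (x : F) : root P x = (x ^+ p == x).
  by rewrite /root /P !hornerE subr_eq0.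
have uP : uniq rs.
  rewrite /= map_inj_uniq ?enum_uniq ?andbT.
    by apply/mapP => -[i _ e]; have := nE i; rewrite e eqxx.
  move=> i j /eqP; wlog le_ij : i j / (i <= j)%N.
    by move=> H; case/orP: (leq_total i j) => /H // {}H; rewrite eq_sym => /H.
  rewrite eq_sym -subr_eq0 -natrB // -(dvdn_pcharf pF) => d.
  apply/val_inj/eqP; rewrite /= eqn_leq le_ij /= -subn_eq0.
  apply: contraTT d => d; rewrite gtnNdvd // ?lt0n //.
  exact: leq_ltn_trans (leq_subr _ _) (ltn_ord j).
have rP : all (root P) rs.
  rewrite /= rootE ap eqxx /=; apply/allP => x /mapP[i _ ->].
  by rewrite rootE -(pFrobenius_autE pF) rmorph_nat.
by have := max_poly_roots P0 rP uP; rewrite sP /= size_image card_ord ltnn.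
Qed.

(** Take psi(u) = zeta^(Tr u): the absolute trace is additive and fixed by Frobenius, so its values
    are classes of integers mod p. *)
Lemma additive_character_exists (F : finFieldType) (p h : nat) (K : fieldType)
    (zeta : K) :
  #|F| = (p ^ h)%N -> p \in [pchar F] -> p.-primitive_root zeta ->
  exists psi : F -> K,
  [/\ forall u, exists n, psi u = zeta ^+ n,
      {morph psi : u v / u + v >-> u * v},
      forall u, psi (u ^+ p) = psi u & exists u, psi u != 1].
Proof.
move=> cF pF zP; have pp := pcharf_prime pF.
have q1 := finNzRing_gt1 F.
case: h cF => [|h] cF; first by rewrite cF in q1.
pose tr (u : F) := \sum_(i < h.+1) u ^+ (p ^ i).
have frob i (u v : F) : (u + v) ^+ (p ^ i) = u ^+ (p ^ i) + v ^+ (p ^ i).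
  by apply: exprDn_pchar; rewrite pnatX pnatE // pF.
have trD u v : tr (u + v) = tr u + tr v.
  by rewrite /tr -big_split; apply: eq_bigr => i _; apply: frob.
have trF u : tr (u ^+ p) = tr u.
  rewrite /tr big_ord_recr big_ord_recl /= -!exprM -expnS -cF expf_card addrC.
  by congr (_ + _); apply: eq_bigr => i _; rewrite -exprM -expnS.
have trp u : tr u ^+ p = tr u.
  rewrite -[RHS]trF -(pFrobenius_autE pF) rmorph_sum; apply: eq_bigr => i _ /=.
  by rewrite pFrobenius_autE exprAC.
pose n u := odflt (Ordinal (prime_gt0 pp)) [pick i : 'I_p | i%:R == tr u].
have nE u : (n u)%:R = tr u.
  rewrite /n; case: pickP => [i /eqP //|] /= nex.
  by have [i e] := pchar_fixed_nat pF (trp u); have := nex i; rewrite e eqxx.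
have zE i j : i%:R = j%:R :> F -> zeta ^+ i = zeta ^+ j.
  move=> e; apply/eqP; rewrite (eq_prim_root_expr zP).
  wlog le_ij : i j e / (i <= j)%N.
    move=> H; case/orP: (leq_total i j) => [|ji]; first exact: H.
    by rewrite eq_sym; apply: H.
  by rewrite eq_sym eqn_mod_dvd // (dvdn_pcharf pF) natrB // e subrr.
exists (fun u => zeta ^+ n u); split.
- by move=> u; exists (n u).
- by move=> u v; rewrite -exprD; apply: zE; rewrite natrD !nE trD.
- by move=> u; apply: zE; rewrite !nE trF.
(* The trace polynomial is nonzero, its X-coefficient being 1, and has degree at most p^h < p^(h+1)
   = |F|, so the trace is not identically zero. *)
pose P : {poly F} := \sum_(i < h.+1) 'X^(p ^ i).
have P0 : P != 0.
  apply/eqP => /(congr1 (fun P : {poly F} => P`_1)); rewrite coef0 coef_sum.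
  rewrite big_ord_recl coefXn /= big1 ?addr0 => [/eqP|i _]; first by rewrite oner_eq0.
  rewrite coefXn /bump /= -[1%N](expn0 p) eqn_exp2l //; exact: prime_gt1.
have sP : (size P <= (p ^ h).+1)%N.
  apply: (leq_trans (size_sum _ _ _)); apply/bigmax_leqP => i _.
  by rewrite size_polyXn ltnS leq_exp2l ?prime_gt1 // -ltnS.
have : ~~ all (root P) (enum F).
  apply/negP => rP; have := max_poly_roots P0 rP (enum_uniq _).
  rewrite -cardE cF => /leq_trans /(_ sP); rewrite ltnS leq_exp2l ?prime_gt1 //.
  by rewrite ltnn.
case/allPn => u _; rewrite /root /P horner_sum => nz; exists u.
rewrite -(prim_order_dvd zP) (dvdn_pcharf pF) nE /tr.
by under eq_bigr do rewrite -hornerXn.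
Qed.

(** * Base-p digits *)

Definition digit_sum (p h j : nat) : nat := \sum_(i < h) (j %/ p ^ i) %% p.

Lemma digit_sumS p h j :
  digit_sum p h.+1 j = (j %% p + digit_sum p h (j %/ p))%N.
Proof.
rewrite /digit_sum big_ord_recl divn1; congr addn.
by apply: eq_bigr => i _; rewrite expnS divnMA.
Qed.

Lemma digit_sum0 p h : digit_sum p h 0 = 0%N.
Proof. by rewrite /digit_sum big1 // => i _; rewrite div0n mod0n. Qed.

(** Multiplication by p shifts the word by one place, and the digit pushed out at the top is 0. *)
Lemma digit_sumMp p h b : (1 < p)%N -> (p * b < p ^ h)%N ->
  digit_sum p h (p * b) = digit_sum p h b.
Proof.
move=> p1; case: h => [|h]; first by rewrite /digit_sum !big_ord0.
rewrite expnS ltn_pmul2l ?(ltnW p1) // => bh.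
rewrite digit_sumS modnMr mulKn ?(ltnW p1) // add0n.
by rewrite {2}/digit_sum big_ord_recr /= (divn_small bh) mod0n addn0.
Qed.

(** Since p does not divide j + 1, the last digit of j is below p - 1 and no carry occurs. *)
Lemma digit_sum_succ p h j : (1 < p)%N -> (j.+1 < p ^ h)%N -> ~~ (p %| j.+1)%N ->
  digit_sum p h j.+1 = (digit_sum p h j).+1.
Proof.
move=> p1; case: h => [|h] // _ pj; rewrite !digit_sumS.
have e : (j.+1 = j %/ p * p + (j %% p).+1)%N by rewrite addnS -divn_eq.
have rp : ((j %% p).+1 < p)%N.
  rewrite ltn_neqAle ltn_pmod ?(ltnW p1) // andbT.
  by apply: contraNN pj => /eqP r; rewrite e r dvdn_addr ?dvdn_mull.
rewrite [in LHS]e modnMDl divnMDl ?(ltnW p1) // (modn_small rp) (divn_small rp).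
by rewrite addn0 addSn.
Qed.

Lemma digit_sum_max p h : (1 < p)%N -> digit_sum p h (p ^ h).-1 = (h * p.-1)%N.
Proof.
move=> p1; have p0 := ltnW p1.
elim: h => [|h IH]; first by rewrite /digit_sum big_ord0.
have ph : (0 < p ^ h)%N by rewrite expn_gt0 p0.
have -> : (p ^ h.+1).-1 = ((p ^ h).-1 * p + p.-1)%N.
  by rewrite expnS; nia.
by rewrite digit_sumS modnMDl divnMDl // modn_small ?divn_small ?addn0 ?IH ?mulSn ?prednK.
Qed.

(** * Multiplicative character sums and power sums over a finite field *)

Lemma sum_multiplicative0 (F : finFieldType) (L : idomainType) (D : pred F)
    (g : F) (f : F -> L) : g != 0 -> (forall u, D (g * u) = D u) ->
  {morph f : u v / u * v} -> f g != 1 -> \sum_(u | D u) f u = 0.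
Proof.
move=> g0 Dg fM fg.
(* Multiplication by g permutes D, so the sum is f(g) times itself. *)
have e : \sum_(u | D u) f u = f g * \sum_(u | D u) f u.
  rewrite [LHS](reindex_inj (mulfI g0)) mulr_sumr.
  by apply: eq_big => u; rewrite ?Dg // fM.
apply/eqP; have : (1 - f g) * \sum_(u | D u) f u == 0.
  by rewrite mulrBl mul1r -e subrr.
by rewrite mulf_eq0 subr_eq0 eq_sym (negPf fg).
Qed.

Lemma natr_card_finField (F : finFieldType) : #|F|%:R = 0 :> F.
Proof.
have : \sum_(u : F) u = \sum_(u : F) (u + 1) by rewrite [LHS](reindex_inj (addIr 1)).
by rewrite big_split sumr_const /= -[LHS]addr0 => /addrI <-.
Qed.

Lemma natr_card_pred_neq0 (F : finFieldType) : #|F|.-1%:R != 0 :> F.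
Proof.
have q0 : (0 < #|F|)%N := ltnW (finNzRing_gt1 F).
have := natr_card_finField F; rewrite -[in X in X%:R](prednK q0) -natr1.
by move=> e; apply/eqP => e0; move: e; rewrite e0 add0r => /eqP; rewrite oner_eq0.
Qed.

Lemma sum_powers_finField (F : finFieldType) e :
  \sum_(u : F) u ^+ e = if (0 < e)%N && (#|F|.-1 %| e)%N then - 1 else 0.
Proof.
have q1 := finNzRing_gt1 F; have q0 := ltnW q1.
have [g gP] := finField_prim_root F.
have [->|e0] := posnP e.
  by rewrite (eq_bigr (fun=> 1)) ?sumr_const ?natr_card_finField.
have [de|de] /= := boolP (#|F|.-1 %| e)%N.
  rewrite (bigD1 0) //= expr0n (gtn_eqF e0) add0r.
  rewrite (eq_bigr (fun=> 1)) => [|u u0]; last first.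
    case/dvdnP: de => c ->; rewrite mulnC exprM.
    by rewrite expf_card_pred // expr1n.
  rewrite sumr_const (cardC1 (0 : F)).
  have := natr_card_finField F; rewrite -[in LHS](prednK q0) -natr1 => /eqP.
  by rewrite addr_eq0 => /eqP.
apply: (sum_multiplicative0 (g := g)) => //.
- by rewrite (prim_root_eq0 gP) -lt0n (prim_order_gt0 gP).
- by move=> u v; rewrite exprMn.
by rewrite -(prim_order_dvd gP).
Qed.

(* The reduction of the Jacobi sum of the (-1)-st and b-th powers of the
   Teichmuller character. *)
Lemma sum_Jacobi_finField (F : finFieldType) b : (0 < b < #|F|.-1)%N ->
  \sum_(u : F) u ^+ #|F|.-2 * (1 - u) ^+ b = b%:R.
Proof.
move=> /andP[b0 bF].
transitivity (\sum_(i < b.+1) \sum_(u : F) (u ^+ (#|F|.-2 + i) * (- 1) ^+ i) *+ 'C(b, i)).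
  rewrite exchange_big; apply: eq_bigr => u _.
  rewrite exprDn mulr_sumr; apply: eq_bigr => i _.
  by rewrite expr1n mul1r [(- u) ^+ i]exprNn exprD mulrnAr [(-1) ^+ i * _]mulrC mulrA.
(* Among the exponents |F| - 2 + i with i <= b < |F| - 1, only i = 1 gives a multiple of |F| - 1;
   its term is (-1)(-1)b. *)
have i1 : (1 < b.+1)%N by [].
rewrite (bigD1 (Ordinal i1)) //= [X in _ + X]big1 ?addr0.
  rewrite sumrMnl -mulr_suml sum_powers_finField addn1 prednK ?(leq_trans b0 (ltnW bF)) //.
  by rewrite dvdnn bin1 expr1 mulrNN mulr1.
move=> i; rewrite -val_eqE /= => i_n1.
rewrite sumrMnl -mulr_suml sum_powers_finField.
rewrite ifF ?mul0r ?mul0rn //; apply/negP => /andP[_ /dvdnP[c]].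
case: i i_n1 => i /= lt_i i_n1; move: bF; move: #|F|.-1 => M bF.
case: c => [|[|c]]; rewrite ?mul0n ?mul1n ?mulSn; lia.
Qed.

(** * Cyclic digit rotations and the weight bound *)

Section DigitRotation.
Local Open Scope nat_scope.

Lemma ceil_div_leq a b c : 0 < b -> (ceil_div a b <= c) = (a <= b * c).
Proof. by move=> b0; rewrite /ceil_div -ltnS ltn_divLR //; nia. Qed.

Lemma digit_expansion p h j : 0 < p -> j < p ^ h ->
  j = \sum_(i < h) (j %/ p ^ i) %% p * p ^ i.
Proof.
move=> p0; elim: h j => [|h IH] j jh; first by rewrite big_ord0; case: j jh.
rewrite big_ord_recl divn1 muln1 {1}(divn_eq j p) addnC; congr addn.
have jp : j %/ p < p ^ h by rewrite ltn_divLR // -expnSr.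
rewrite [in LHS](IH _ jp) big_distrl; apply: eq_bigr => i _.
by rewrite /= -divnMA -expnS -mulnA -expnSr.
Qed.

(* The base-p word of length h of j, cyclically rotated by l places. *)
Definition digit_rot (p h l j : nat) : nat :=
  \sum_(i < h) (j %/ p ^ i) %% p * p ^ ((i + l) %% h).

(** As p^h is 1 modulo p^h - 1, the power p^(i + l) depends only on i + l modulo h. *)
Lemma digit_rot_mod p h l j : 0 < p -> j < p ^ h ->
  digit_rot p h l j = p ^ l * j %[mod (p ^ h).-1].
Proof.
move=> p0 jh; rewrite [in RHS](digit_expansion p0 jh) big_distrr /=.
apply: (big_ind2 (fun a b => a = b %[mod (p ^ h).-1])) => //.
  by move=> a b a' b' e e'; rewrite -modnDm e e' modnDm.
have ph : p ^ h = 1 %[mod (p ^ h).-1].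
  by rewrite -[X in X = _ %[mod _]](prednK (_ : 0 < p ^ h)) ?expn_gt0 ?p0 // -addn1 modnDl.
have phX c : (p ^ h) ^ c = 1 %[mod (p ^ h).-1] by rewrite -modnXm ph modnXm exp1n.
have pX n : p ^ n = p ^ (n %% h) %[mod (p ^ h).-1].
  by rewrite {1}(divn_eq n h) expnD [_ * h]mulnC expnM -modnMml phX modnMml mul1n.
by move=> i _; rewrite mulnCA -expnD [l + i]addnC -[in RHS]modnMmr pX modnMmr.
Qed.

Lemma digit_rot_gt0 p h l j : 0 < p -> j < p ^ h -> 0 < j -> 0 < digit_rot p h l j.
Proof.
move=> p0 jh; rewrite {1}(digit_expansion p0 jh) !lt0n.
apply: contraNN; rewrite /digit_rot !sum_nat_eq0 => /forallP H.
by apply/forallP => i; have := H i; rewrite !muln_eq0 !expn_eq0 (gtn_eqF p0) !orbF.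
Qed.

(** Over all h rotations each digit visits each place once, so it is weighted by 1 + p + ... +
    p^(h-1). *)
Lemma sum_digit_rot p h j :
  p.-1 * \sum_(l < h) digit_rot p h l j = (p ^ h).-1 * digit_sum p h j.
Proof.
rewrite exchange_big predn_exp -mulnA; congr (_ * _).
rewrite /digit_sum big_distrr; apply: eq_bigr => i _ /=.
rewrite -big_distrr mulnC; congr (_ * _).
case: h i => [|h] i; first by case: i.
by rewrite [RHS](reindex_inj (addrI i)).
Qed.

Section Weights.
Variables (p h q k d r : nat).
Variables (mu : 'I_r -> 'I_k -> nat) (J : 'I_r -> nat).
Hypotheses (p_gt0 : 0 < p) (q_gt1 : 1 < q) (d_gt0 : 0 < d).
Hypothesis q_dvd : q.-1 %| (p ^ h).-1.
Hypothesis mu_deg : forall s, \sum_i mu s i <= d.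
Hypothesis J_lt : forall s, J s < p ^ h.
Hypothesis J_dvd : q.-1 %| \sum_s J s.
Hypothesis Jmu_dvd : forall i, (p ^ h).-1 %| \sum_s J s * mu s i.

(** The variables x_i that appear with exponent 0. Summing over such a variable gives |F| = p^h,
    which supplies h(p - 1) factors pi and makes up for the missing degree. *)
Let zeros := #|[pred i | \sum_s J s * mu s i == 0]|.

(** Rotation preserves the divisibilities and the vanishing of each J s. So every variable outside
    [zeros] has a rotated exponent that is a positive multiple of p^h - 1, while the total over all
    variables is at most d times the sum of the rotated J s. *)
Lemma sum_digit_rot_geq l :
  q.-1 * ceil_div (k * (p ^ h).-1) (d * q.-1)
  <= \sum_s digit_rot p h l (J s) + zeros * (p ^ h).-1.
Proof.
have q0 : 0 < q.-1 by rewrite -ltnS prednK // ltnW.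
have rotE s : digit_rot p h l (J s) = p ^ l * J s %[mod (p ^ h).-1].
  exact: digit_rot_mod.
have rotq s : digit_rot p h l (J s) = p ^ l * J s %[mod q.-1].
  by rewrite -(modn_dvdm _ q_dvd) rotE modn_dvdm.
have sum_mod n I (P Q : I -> nat) (s : seq I) : (forall i, P i = Q i %[mod n]) ->
    \sum_(i <- s) P i = \sum_(i <- s) Q i %[mod n].
  move=> e; apply: (big_ind2 (fun a b => a = b %[mod n])) => //.
  by move=> a b a' b' e1 e2; rewrite -modnDm e1 e2 modnDm.
have /dvdnP[a aE] : q.-1 %| \sum_s digit_rot p h l (J s).
  by rewrite /dvdn (sum_mod _ _ _ _ _ rotq) -big_distrr -/(dvdn _ _) dvdn_mull.
have key : k * (p ^ h).-1 <= d * (\sum_s digit_rot p h l (J s)) + zeros * (p ^ h).-1.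
  apply: leq_trans (_ : \sum_(i < k) (\sum_s digit_rot p h l (J s) * mu s i +
     (\sum_s J s * mu s i == 0) * (p ^ h).-1) <= _).
    rewrite -[k in k * _]card_ord -sum_nat_const leq_sum // => i _.
    have [_|e0] := eqVneq (\sum_s J s * mu s i) 0; first by rewrite mul1n leq_addl.
    rewrite mul0n addn0 dvdn_leq //.
      move: e0; rewrite -lt0n !lt0n; apply: contraNN; rewrite !sum_nat_eq0 => /forallP H.
      apply/forallP => s; have := H s; rewrite /= !muln_eq0 => /orP[|->]; last by rewrite orbT.
      have [->//|Js] := posnP (J s).
      by rewrite (gtn_eqF (digit_rot_gt0 _ p_gt0 (J_lt s) Js)).
    rewrite /dvdn (sum_mod _ _ _ (fun s => p ^ l * (J s * mu s i))) => [|s].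
      by rewrite -big_distrr -/(dvdn _ _) dvdn_mull.
    by rewrite mulnA -modnMml rotE modnMml.
  rewrite big_split /= -big_distrl /= exchange_big /= leq_add //.
    by rewrite big_distrr leq_sum // => s _; rewrite -big_distrr /= mulnC leq_mul2r mu_deg orbT.
  rewrite /zeros -sum1_card eq_leq //; congr (_ * _).
  by rewrite [RHS]big_mkcond; apply: eq_bigr => i _; rewrite inE; case: eqP.
(* Both summands on the right are multiples of q - 1, so the integer a + zeros g can be compared
   with the inner ceiling; d >= 1 absorbs the factor d put on the [zeros] term. *)
case/dvdnP: q_dvd => g gE.
rewrite aE gE in key *.
have -> : a * q.-1 + zeros * (g * q.-1) = q.-1 * (a + zeros * g) by ring.
rewrite leq_mul2l ceil_div_leq ?muln_gt0 ?d_gt0 //; apply/orP; right.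
apply: leq_trans key _.
have -> : d * q.-1 * (a + zeros * g) = d * (a * q.-1) + d * (zeros * (g * q.-1)) by ring.
by rewrite leq_add2l leq_pmull.
Qed.

(** Sum the preceding bound over the h rotations: [sum_digit_rot] turns the rotated values into
    digit sums. *)
Lemma sum_digit_sum_geq :
  p.-1 * (h * (q.-1 * ceil_div (k * (p ^ h).-1) (d * q.-1)))
  <= (p ^ h).-1 * (\sum_s digit_sum p h (J s) + zeros * (h * p.-1)).
Proof.
have := leq_sum (index_enum 'I_h) (fun (l : 'I_h) (_ : true) => sum_digit_rot_geq l).
rewrite sum_nat_const card_ord big_split /= sum_nat_const card_ord exchange_big.
move=> /(leq_mul (leqnn p.-1)) /leq_trans; apply.
rewrite mulnDr [X in _ <= X]mulnDr leq_add //.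
  by rewrite !big_distrr /= leq_sum // => s _; rewrite sum_digit_rot.
by apply: eq_leq; ring.
Qed.

End Weights.

End DigitRotation.

(** * Gauss sums and counting *)

Section GaussSums.
Variables (F : finFieldType) (p h : nat).
Hypotheses (cF : #|F| = (p ^ h)%N) (pF : p \in [pchar F]).
Variables (K : fieldType) (w : K) (t : F) (zeta : K) (T psi : F -> K).
Hypothesis ker : forall P, int_eval P w = 0 -> int_eval P t = 0.
Hypothesis zetaP : p.-primitive_root zeta.
Hypothesis red_zeta : red w t zeta 1.
Hypothesis TM : {morph T : u v / u * v}.
Hypothesis red_T : forall u, red w t (T u) u.
Hypothesis psi_zeta : forall u, exists n, psi u = zeta ^+ n.
Hypothesis psiD : {morph psi : u v / u + v >-> u * v}.
Hypothesis psiF : forall u, psi (u ^+ p) = psi u.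
Hypothesis psi_neq1 : exists u, psi u != 1.
Local Notation red := (red w t).
Local Notation pi_dvd := (pi_dvd w t zeta).

Let p_prime : prime p := pcharf_prime pF.
Let q_gt1 : (1 < #|F|)%N := finNzRing_gt1 F.
Let q_gt0 : (0 < #|F|)%N := ltnW q_gt1.

(** T 0 is idempotent, hence 0 or 1, and 1 is excluded because T 0 reduces to 0. *)
Lemma Teich_eq0 u : (T u == 0) = (u == 0).
Proof.
apply/eqP/eqP => [Tu|->].
  by apply: (red_inj ker (red_T u)); rewrite Tu; apply: red0.
apply/eqP; have := congr1 T (mul0r (0 : F)); rewrite TM => /eqP.
rewrite -subr_eq0 -[X in _ - X]mulr1 -mulrBr mulf_eq0 subr_eq0.
case/orP => // /eqP T1; have := red_inj ker (red_T 0).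
by rewrite T1 => /(_ 1 (red1 _ _))/eqP; rewrite eq_sym oner_eq0.
Qed.

Lemma Teich0 : T 0 = 0. Proof. by apply/eqP; rewrite Teich_eq0. Qed.

Lemma Teich1 : T 1 = 1.
Proof.
have T1 : T 1 != 0 by rewrite Teich_eq0 oner_eq0.
by apply: (mulfI T1); rewrite -TM !mulr1.
Qed.

Lemma TeichX u n : T (u ^+ n) = T u ^+ n.
Proof. by elim: n => [|n IH]; rewrite ?Teich1 // !exprS TM IH. Qed.

Lemma Teich_prod I (r : seq I) (P : pred I) (f : I -> F) :
  T (\prod_(i <- r | P i) f i) = \prod_(i <- r | P i) T (f i).
Proof. by apply: (big_morph T TM Teich1). Qed.

Lemma Teich_inj : injective T.
Proof. by move=> u v e; apply: (red_inj ker (red_T u)); rewrite e. Qed.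

(** Positivity of the exponents covers u = 0, where 0 ^+ 0 = 1. *)
Lemma Teich_eq_mod u a b : (0 < a)%N -> (0 < b)%N -> a = b %[mod #|F|.-1] ->
  T u ^+ a = T u ^+ b.
Proof.
move=> a0 b0 ab; have [->|u0] := eqVneq u 0.
  by rewrite Teich0 !expr0n !gtn_eqF.
by rewrite -!TeichX -(expr_mod a (expf_card_pred u0)) ab (expr_mod b (expf_card_pred u0)).
Qed.

Lemma sum_Teich e : ~~ (#|F|.-1 %| e)%N -> \sum_u T u ^+ e = 0.
Proof.
move=> de; have [g gP] := finField_prim_root F.
apply: (sum_multiplicative0 (g := g)) => //.
- by rewrite (prim_root_eq0 gP) -lt0n (prim_order_gt0 gP).
- by move=> u v; rewrite TM exprMn.
by rewrite -TeichX -Teich1 (inj_eq Teich_inj) -(prim_order_dvd gP).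
Qed.

(** The solutions of u^q = u are stable under an element of order q - 1, on which T^e is
    nontrivial. *)
Lemma sum_Teich_subfield q e : (0 < q)%N -> (q.-1 %| #|F|.-1)%N ->
  ~~ (q.-1 %| e)%N -> \sum_(u | u ^+ q == u) T u ^+ e = 0.
Proof.
move=> q0 dq de; have [g0 g0P] := finField_prim_root F.
have gP := dvdn_prim_root g0P dq; set g := g0 ^+ _ in gP.
have g0' : g != 0 by rewrite (prim_root_eq0 gP) -lt0n (prim_order_gt0 gP).
apply: (sum_multiplicative0 (g := g)) => //.
- move=> u; rewrite exprMn -[in g ^+ q](prednK q0) exprS (prim_expr_order gP) mulr1.
  by rewrite (inj_eq (mulfI g0')).
- by move=> u v; rewrite TM exprMn.
by rewrite -TeichX -Teich1 (inj_eq Teich_inj) -(prim_order_dvd gP).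
Qed.

Lemma psi0 : psi 0 = 1.
Proof.
have p0 : psi 0 != 0.
  have [n ->] := psi_zeta 0; rewrite expf_eq0 (prim_root_eq0 zetaP).
  by rewrite (gtn_eqF (prime_gt0 p_prime)) andbF.
by apply: (mulfI p0); rewrite -psiD addr0 mulr1.
Qed.

Lemma psi_sum I (r : seq I) (P : pred I) (f : I -> F) :
  psi (\sum_(i <- r | P i) f i) = \prod_(i <- r | P i) psi (f i).
Proof. by apply: (big_morph psi psiD psi0). Qed.

Lemma psi_pX u n : psi (u ^+ (p ^ n)) = psi u.
Proof.
by elim: n => [|n IH]; rewrite ?expn0 ?expr1 // expnSr exprM psiF.
Qed.

Lemma sum_psi v : \sum_u psi (u * v) = if v == 0 then #|F|%:R else 0.
Proof.
have [->|v0] := eqVneq v 0.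
  by rewrite (eq_bigr (fun=> 1)) ?sumr_const // => u _; rewrite mulr0 psi0.
have [x px] := psi_neq1.
have -> : \sum_u psi (u * v) = \sum_u psi u by rewrite [RHS](reindex_inj (mulIf v0)).
have e : \sum_u psi u = psi x * \sum_u psi u.
  by rewrite [LHS](reindex_inj (addrI x)) mulr_sumr; apply: eq_bigr => u _.
apply/eqP; have : (1 - psi x) * \sum_u psi u == 0.
  by rewrite mulrBl mul1r -e subrr.
by rewrite mulf_eq0 subr_eq0 eq_sym (negPf px).
Qed.

Lemma sum_psi0 : \sum_u psi u = 0.
Proof.
have := sum_psi 1; rewrite oner_eq0.
by under eq_bigr do rewrite mulr1.
Qed.

Definition gauss a : K := \sum_u T u ^+ a * psi u.

Lemma gauss_eq_mod a b : (0 < a)%N -> (0 < b)%N -> a = b %[mod #|F|.-1] ->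
  gauss a = gauss b.
Proof. by move=> a0 b0 ab; apply: eq_bigr => u _; rewrite (Teich_eq_mod u a0 b0 ab). Qed.

(** Frobenius permutes F and leaves psi invariant. *)
Lemma gauss_Mp a : gauss (p * a) = gauss a.
Proof.
rewrite /gauss [RHS](reindex_inj (h := fun u => u ^+ p)) /=.
  by apply: eq_bigr => u _; rewrite psiF TeichX -exprM.
by move=> u v; rewrite -!(pFrobenius_autE pF); apply: fmorph_inj.
Qed.

(** Group the double sum by s, the sum of the two arguments. The part s = 0 vanishes by
    orthogonality, and for s nonzero scaling u by s extracts T(s)^(a+b) from a Jacobi sum. *)
Lemma gaussM a b : (0 < a)%N -> ~~ (#|F|.-1 %| a + b)%N ->
  gauss a * gauss b = (\sum_u T u ^+ a * T (1 - u) ^+ b) * gauss (a + b).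
Proof.
move=> a0 dab.
transitivity (\sum_s (\sum_u T u ^+ a * T (s - u) ^+ b) * psi s).
  transitivity (\sum_u \sum_s (T u ^+ a * T (s - u) ^+ b) * psi s).
    rewrite /gauss mulr_suml; apply: eq_bigr => u _.
    rewrite mulr_sumr [LHS](reindex_inj (addIr (- u))); apply: eq_bigr => s _.
    by rewrite mulrACA -psiD [u + _]addrC subrK.
  by rewrite exchange_big; apply: eq_bigr => s _; rewrite mulr_suml.
rewrite /gauss mulr_sumr; apply: eq_bigr => s _; rewrite mulrA; congr (_ * _).
have [->|s0] := eqVneq s 0.
  rewrite Teich0 expr0n addn_eq0 (gtn_eqF a0) mulr0.
  rewrite (eq_bigr (fun u => T (- 1) ^+ b * T u ^+ (a + b))) => [|u _].
    by rewrite -mulr_sumr sum_Teich // mulr0.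
  by rewrite sub0r -[- u]mulN1r TM exprMn exprD mulrCA.
rewrite (reindex_inj (mulfI s0)) mulr_suml; apply: eq_bigr => u _.
by rewrite -[s in s - _]mulr1 -mulrBr !TM !exprMn exprD mulrACA [RHS]mulrC.
Qed.

(** The sum of T^a is 0, so psi may be replaced by psi - 1, whose values are divisible by pi. *)
Lemma gauss_dvd1 a : ~~ (#|F|.-1 %| a)%N -> pi_dvd 1 (gauss a).
Proof.
move=> da; have -> : gauss a = \sum_u T u ^+ a * (psi u - 1).
  under [RHS]eq_bigr do rewrite mulrBr mulr1.
  by rewrite big_split sumrN /= (sum_Teich da) subr0.
apply: pi_dvd_sum => u _; rewrite -[1%N]add0n.
apply: pi_dvdM; first exact/pi_dvd_red/redX/red_T.
by have [n ->] := psi_zeta u; apply: pi_dvd_zetaX.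
Qed.

(* Induction on j: if p divides j, Frobenius replaces j by j / p; otherwise the
   Jacobi sum linking j with 1 and j - 1 reduces to -j, a unit. *)
Lemma gauss_dvd j : (0 < j < #|F|.-1)%N ->
  pi_dvd (digit_sum p h j) (gauss (#|F|.-1 - j)).
Proof.
have p1 := prime_gt1 p_prime.
elim/ltn_ind: j => j IH /andP[j0 jF].
have ndj x : (0 < x < #|F|.-1)%N -> ~~ (#|F|.-1 %| x)%N.
  by move=> /andP[x0 xF]; rewrite gtnNdvd.
have jph : (j < p ^ h)%N by rewrite -cF; apply: leq_trans jF (leq_pred _).
have [/dvdnP[b jE]|pj] := boolP (p %| j)%N.
  rewrite {}jE mulnC in IH j0 jF jph *.
  move: j0; rewrite muln_gt0 => /andP[p0 b0].
  have bj : (b < p * b)%N by rewrite ltn_Pmull.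
  have bF := ltn_trans bj jF.
  rewrite digit_sumMp // (_ : gauss _ = gauss (#|F|.-1 - b)).
    by apply: IH; rewrite ?b0.
  rewrite -[RHS]gauss_Mp; apply: gauss_eq_mod; rewrite ?subn_gt0 ?muln_gt0 ?subn_gt0 ?p0 //.
  rewrite mulnBr; have -> : (p * #|F|.-1 - p * b = p.-1 * #|F|.-1 + (#|F|.-1 - p * b))%N.
    by rewrite addnBA 1?ltnW // -mulSnr prednK.
  by rewrite modnMDl.
case: j IH j0 jF jph pj => // j IH _ jF jph pj; rewrite digit_sum_succ //.
have [->|j0] := posnP j.
  by rewrite digit_sum0; apply/gauss_dvd1/ndj; lia.
(* Here j is the predecessor of the index treated. Modulo |F| - 1, b stands for -j and |F| - 2 for
   -1, so the product of their Gauss sums belongs to -(j + 1). *)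
set b := (#|F|.-1 - j)%N.
have nab : ((#|F|.-2 + b) = (#|F|.-1 - j.+1) %[mod #|F|.-1])%N.
  have -> : (#|F|.-2 + b = #|F|.-1 + (#|F|.-1 - j.+1))%N by rewrite /b; lia.
  by rewrite modnDl.
have bF : (0 < b < #|F|.-1)%N by rewrite /b; lia.
have nd : ~~ (#|F|.-1 %| #|F|.-2 + b)%N.
  by rewrite /dvdn nab -/(dvdn _ _) ndj //; lia.
have a0 : (0 < #|F|.-2)%N by lia.
have := gaussM a0 nd.
rewrite (@gauss_eq_mod (_ + b) (#|F|.-1 - j.+1)) //; [|lia|lia] => e.
apply: (@pi_dvd_unitM _ _ w t zeta _ _ b%:R).
- rewrite -(sum_Jacobi_finField bF).
  apply: red_sum => u _; apply: redM; apply: redX; first exact: red_T.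
  exact: (red_T (1 - u)).
(* Since (j + 1) + b = |F| is divisible by p, p dividing b would make p divide j + 1. *)
- rewrite -(dvdn_pcharf pF); apply: contra pj => pb.
  have pQ : (p %| #|F|)%N by rewrite (dvdn_pcharf pF) natr_card_finField.
  by rewrite -(dvdn_addl _ pb) (_ : j.+1 + b = #|F|)%N // /b; lia.
rewrite -e -add1n; apply: pi_dvdM; first by apply/gauss_dvd1/ndj; lia.
by apply: IH => //; lia.
Qed.

(* Separating the endpoints makes the expansion of psi hold at v = 0 too. *)
Definition psi_coef j : K :=
  if j == 0%N then #|F|.-1%:R
  else if j == #|F|.-1 then - #|F|%:R else gauss (#|F|.-1 - j).

(** At j = |F| - 1 all h digits are p - 1, matched by the h(p - 1) factors pi of p^h; the interior
    indices are covered by [gauss_dvd]. *)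
Lemma psi_coef_dvd j : (j < #|F|)%N -> pi_dvd (digit_sum p h j) (psi_coef j).
Proof.
rewrite /psi_coef => jF; have [->|j0] := posnP j.
  by rewrite digit_sum0; apply/pi_dvd_red/red_nat.
have [->|jq] := eqVneq j #|F|.-1.
  rewrite [in digit_sum _ _ _]cF digit_sum_max ?prime_gt1 //.
  rewrite -mulN1r -[X in pi_dvd X]add0n; apply: pi_dvdM.
    by apply/pi_dvd_red/redN/red1.
  by rewrite cF natrX; apply/pi_dvdX/(pi_dvd_p pF zetaP red_zeta).
apply: gauss_dvd; rewrite j0 ltn_neqAle jq -ltnS prednK //.
Qed.

Lemma psi_expansion v :
  #|F|.-1%:R * psi v = \sum_(j < #|F|) psi_coef j * T v ^+ j.
Proof.
have [M FE] : exists M, #|F|.-1 = M.+1 by case: #|F| q_gt1 => [|[|M]] //; exists M.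
have FE2 : #|F| = M.+2 by rewrite -FE prednK.
rewrite FE2 big_ord_recl big_ord_recr /= /psi_coef /bump /= FE !add1n eqxx FE2 mulr1.
under eq_bigr => i _ do rewrite eqSS (ltn_eqF (ltn_ord i)) subSS.
have [->|v0] := eqVneq v 0.
  rewrite Teich0 psi0 !expr0n /= mulr0 addr0 mulr1 big1 ?addr0 // => i _.
  by rewrite expr0n mulr0.
have Tv : T v ^+ M.+1 = 1 by rewrite -FE -TeichX expf_card_pred // Teich1.
suff -> : \sum_(i < M) gauss (M - i) * T v ^+ i.+1 = M.+1%:R * psi v + 1.
  by rewrite Tv -[M.+2]addn1 natrD; ring.
transitivity (\sum_u (\sum_(i < M) T u ^+ (M - i) * T v ^+ i.+1) * psi u).
  rewrite /gauss; under [RHS]eq_bigr => u _ do rewrite mulr_suml.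
  rewrite exchange_big; apply: eq_bigr => i _; rewrite mulr_suml.
  by apply: eq_bigr => u _; rewrite mulrAC.
(* Fourier inversion, with [M.+1] = |F| - 1. For u nonzero the inner sum is a full geometric sum in
   T v / T u without its term 1; for u = 0 it is 0, which the indicator of u = 0 restores. *)
transitivity (\sum_u ((u == v)%:R * M.+1%:R * psi u + (u == 0)%:R * psi u - psi u)).
  apply: eq_bigr => u _; rewrite -mulrDl -[X in _ - X]mul1r -mulrBl; congr (_ * _).
  have [->|u0] := eqVneq u 0.
    rewrite eq_sym (negPf v0) mul0r add0r subrr big1 // => i _.
    by rewrite Teich0 expr0n subn_eq0 leqNgt ltn_ord mul0r.
  have Tu : T u ^+ M.+1 = 1 by rewrite -FE -TeichX expf_card_pred // Teich1.
  have S1 : \sum_(i < M.+1) T u ^+ (M - i) * T v ^+ i = (u == v)%:R * M.+1%:R * T v ^+ M.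
    have [->|uv] := eqVneq u v.
      rewrite mul1r (eq_bigr (fun=> T v ^+ M)) => [|i _]; last first.
        by rewrite -exprD subnK // -ltnS.
      by rewrite sumr_const card_ord mulr_natl.
    rewrite !mul0r; apply: (@mulfI _ (T u - T v)).
      by rewrite subr_eq0 (inj_eq Teich_inj).
    by rewrite mulr0 -[M]/(M.+1.-1) -subrXX Tu Tv subrr.
  rewrite addr0; apply: (addIr 1); rewrite subrK.
  transitivity (T v * \sum_(i < M.+1) T u ^+ (M - i) * T v ^+ i).
    rewrite big_ord_recr /= subnn mul1r mulrDr -exprS Tv mulr_sumr; congr (_ + _).
    by apply: eq_bigr => i _; rewrite exprS mulrCA.
  by rewrite S1 mulrCA -exprS Tv mulr1.
rewrite sumrB big_split sum_psi0 subr0; congr (_ + _).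
  rewrite (bigD1 v) //= eqxx mul1r big1 ?addr0 // => u /negPf ->.
  by rewrite !mul0r.
rewrite (bigD1 0) //= eqxx psi0 mulr1 big1 ?addr0 // => u /negPf ->.
by rewrite !mul0r.
Qed.

(** * Expansion over the monomials and divisibility of the character sum *)

Lemma expansion_prod r (b : 'I_r -> F) :
  #|F|.-1%:R ^+ r * psi (\sum_s b s) =
  \sum_(J : {ffun 'I_r -> 'I_#|F|}) \prod_s (psi_coef (J s) * T (b s) ^+ J s).
Proof.
rewrite psi_sum -[r in _ ^+ r]card_ord -prodr_const -big_split /=.
rewrite -(bigA_distr_bigA (fun s (j : 'I_#|F|) => psi_coef j * T (b s) ^+ j)).
by apply: eq_bigr => s _; apply: psi_expansion.
Qed.

Lemma char_sum_dvd (q k d r : nat) (a : 'I_r -> F) (mu : 'I_r -> 'I_k -> nat) :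
  (1 < q)%N -> (0 < d)%N -> (q.-1 %| #|F|.-1)%N ->
  (forall s, \sum_i mu s i <= d)%N ->
  pi_dvd (ceil_div (p.-1 * (h * (q.-1 * ceil_div (k * #|F|.-1) (d * q.-1)))) #|F|.-1)
    (\sum_(c : F | c ^+ q == c) \sum_(x : {ffun 'I_k -> F})
       psi (c * \sum_s a s * \prod_i x i ^+ mu s i)).
Proof.
move=> q1 d0 dq mu_d; set W := (p.-1 * _)%N.
have q0 : (0 < #|F|.-1)%N by rewrite -ltnS prednK.
(* The denominators |F| - 1 of the r expansions of psi reduce to units, so they can be cleared. *)
apply: (@pi_dvd_unitM _ _ w t zeta _ (#|F|.-1%:R ^+ r) (#|F|.-1%:R ^+ r)).
- exact/redX/red_nat.
- by rewrite expf_neq0 // natr_card_pred_neq0.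
(* For a choice J of one index per monomial, A J is the coefficient and e J i the exponent of
   T(x_i); the sums over c and over each x_i then separate. *)
pose A (J : {ffun 'I_r -> 'I_#|F|}) := \prod_s (psi_coef (J s) * T (a s) ^+ J s).
pose e (J : {ffun 'I_r -> 'I_#|F|}) i := (\sum_s J s * mu s i)%N.
have -> : #|F|.-1%:R ^+ r * \sum_(c : F | c ^+ q == c) \sum_(x : {ffun 'I_k -> F})
       psi (c * \sum_s a s * \prod_i x i ^+ mu s i) =
   \sum_J A J * ((\sum_(c | c ^+ q == c) T c ^+ (\sum_s J s)) * \prod_i \sum_u T u ^+ e J i).
  rewrite mulr_sumr.
  transitivity (\sum_(c | c ^+ q == c) \sum_(x : {ffun 'I_k -> F}) \sum_J
     A J * (T c ^+ (\sum_s J s) * \prod_i T (x i) ^+ e J i)).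
    apply: eq_bigr => c _; rewrite mulr_sumr; apply: eq_bigr => x _.
    rewrite mulr_sumr expansion_prod; apply: eq_bigr => J _.
    rewrite -prodrXr [X in A J * (_ * X)](_ : _ = \prod_s \prod_i T (x i) ^+ (J s * mu s i)).
      rewrite -!big_split; apply: eq_bigr => s _ /=.
      rewrite !TM !exprMn Teich_prod -prodrXl.
      under [X in _ * (_ * (_ * X))]eq_bigr do rewrite TeichX -exprM mulnC.
      by rewrite -!mulrA; congr (_ * _); rewrite mulrCA.
    rewrite exchange_big; apply: eq_bigr => i _.
    by rewrite -prodrXr.
  under eq_bigr do rewrite exchange_big; rewrite exchange_big /=.
  apply: eq_bigr => J _; rewrite bigA_distr_bigA mulr_suml mulr_sumr.
  apply: eq_bigr => c _; rewrite !mulr_sumr.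
  by apply: eq_bigr => x _.
apply: pi_dvd_sum => J _.
have [dJ|ndJ] := boolP (q.-1 %| \sum_s J s)%N; last first.
  by rewrite (sum_Teich_subfield (ltnW q1) dq ndJ) mul0r mulr0; apply: pi_dvd0.
have [/forallP dmu|/forallPn[i nd]] := boolP [forall i, (#|F|.-1 %| e J i)%N]; last first.
  rewrite (bigD1 i) //= sum_Teich // mul0r !mulr0; apply: pi_dvd0.
pose z := #|[pred i | e J i == 0%N]|.
(* The digit sums come from the coefficients of psi, and each of the z variables with exponent 0
   adds h(p - 1). *)
apply: (pi_dvd_le red_zeta (n := (\sum_s digit_sum p h (J s) + z * (h * p.-1))%N)).
  have := @sum_digit_sum_geq p h q k d r mu (fun s => J s).
  rewrite -cF ceil_div_leq // => H; apply: H => //; exact: prime_gt0.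
apply: pi_dvdM.
  apply: pi_dvd_prod => s _; rewrite -[digit_sum _ _ _]addn0; apply: pi_dvdM.
    exact: psi_coef_dvd.
  exact/pi_dvd_red/redX/red_T.
rewrite -[(z * _)%N]add0n; apply: pi_dvdM.
  apply: pi_dvd_red; apply: red_sum => c _; apply: redX; exact: red_T.
have -> : (z * (h * p.-1) = \sum_i (if e J i == 0%N then h * p.-1 else 0))%N.
  by rewrite -big_mkcond sum_nat_const.
apply: pi_dvd_prod => i _; have [->|_] := eqVneq (e J i) 0%N.
  under eq_bigr do rewrite expr0; rewrite sumr_const cF natrX.
  exact/pi_dvdX/(pi_dvd_p pF zetaP red_zeta).
by apply: pi_dvd_red; apply: red_sum => u _; apply: redX; apply: red_T.
Qed.

(** Orthogonality of psi detects the equation, and the sum over y then leaves only the c with c^q =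
    c. *)
Lemma card_Artin_Schreier (X : finType) (n : nat) (f : X -> F) : (0 < n)%N ->
  #|F|%:R * #|[set xy : X * F | f xy.1 == xy.2 ^+ (p ^ n) - xy.2]|%:R =
  #|F|%:R * \sum_(c : F | c ^+ (p ^ n) == c) \sum_x psi (c * f x).
Proof.
move=> n0; set q := (p ^ n)%N.
have qnat : [pchar F].-nat q by rewrite pnatX pnatE // pF.
have qD (u v : F) : (u - v) ^+ q = u ^+ q - v ^+ q.
  by rewrite exprDn_pchar // exprNn_pchar.
have q_inj : injective (fun u : F => u ^+ q).
  move=> u v /eqP; rewrite -subr_eq0 -qD expf_eq0 subr_eq0 => /andP[_ /eqP].
  by [].
transitivity (\sum_(xy : X * F) \sum_c psi (c * (f xy.1 - (xy.2 ^+ q - xy.2)))).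
  rewrite -sum1_card natr_sum mulr_sumr big_mkcond; apply: eq_bigr => xy _.
  by rewrite sum_psi inE subr_eq0; case: eqP; rewrite ?mulr1.
(* Replacing c by c^q lets Frobenius invariance turn psi(-c^q y^q) into psi(-c y), so the dependence
   on y becomes psi(y (c^q - c)). *)
rewrite exchange_big (reindex_inj q_inj) /=.
transitivity (\sum_c \sum_x psi (c ^+ q * f x) * \sum_y psi (y * (c ^+ q - c))).
  apply: eq_bigr => c _; rewrite -(pair_bigA _ (fun x y =>
    psi (c ^+ q * (f x - (y ^+ q - y))))) /=.
  apply: eq_bigr => x _; rewrite mulr_sumr; apply: eq_bigr => y _.
  have e : (- (c * y)) ^+ q = - (c ^+ q * y ^+ q).
    by rewrite exprNn_pchar // exprMn.
  have -> : c ^+ q * (f x - (y ^+ q - y)) =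
            c ^+ q * f x + (y * c ^+ q + (- (c * y)) ^+ q) by rewrite e; ring.
  rewrite !psiD psi_pX -psiD; congr (_ * psi _); ring.
rewrite mulr_sumr [RHS]big_mkcond; apply: eq_bigr => c _.
rewrite sum_psi subr_eq0; case: eqP => [->|_].
  by rewrite -mulr_suml mulrC.
by rewrite big1 // => x _; rewrite mulr0.
Qed.

End GaussSums.

Local Open Scope nat_scope.

Theorem theorem5p4 (p e m k d : nat) (F : finFieldType) (f : {mpoly F[k]}) :
  prime p -> (0 < e)%N -> (0 < m)%N -> (0 < k)%N ->
  #|F| = ((p ^ e) ^ m)%N ->
  msize f = d.+1 -> (0 < d)%N ->
  (p ^ (ceil_div (e * m * (p ^ e - 1) *
                  ceil_div (k * ((p ^ e) ^ m - 1)) (d * (p ^ e - 1)))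
                 ((p ^ e) ^ m - 1))
     %| Ncount k (p ^ e)%N f)%N.

Proof.
move=> pp e0 m0 k0 cF df d0.
have cFh : #|F| = p ^ (e * m) by rewrite expnM.
have pF := card_finPcharP cFh pp.
have [w [t [zeta [T [ker zP rz TM rT]]]]] := Teichmuller_exists cFh pF.
have [psi [pz pD pFr pn1]] := additive_character_exists cFh pF zP.
rewrite !subn1 -cF.
have q1 : 1 < p ^ e by rewrite -(expn0 p) ltn_exp2l // prime_gt1.
have dq : (p ^ e).-1 %| #|F|.-1 by rewrite cF [((p ^ e) ^ m).-1]predn_exp dvdn_mulr.
pose mon (s : 'I_(size (msupp f))) := tnth (in_tuple (msupp f)) s.
have mu_d s : \sum_i mon s i <= d.
  by rewrite -mdegE -ltnS -df; apply/msize_mdeg_lt/mem_tnth.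
(* Zero is split off because [logn p 0] is 0 rather than infinite. *)
have [->|N0] := posnP (Ncount k (p ^ e) f); first exact: dvdn0.
have := char_sum_dvd cFh pF ker zP rz TM rT pz pD pFr pn1
  (fun s => (f@_(mon s))%R) q1 d0 dq mu_d.
set S := (\sum_(c | _) _)%R => dS.
have NS : ((Ncount k (p ^ e) f)%:R = S :> algC)%R.
  have := card_Artin_Schreier pF zP pz pD pFr pn1
    (fun x : {ffun 'I_k -> F} => f.@[x]%R) e0.
  have qC : (#|F|%:R != 0 :> algC)%R by rewrite pnatr_eq0 cFh expn_eq0 (gtn_eqF (prime_gt0 pp)).
  move/(mulfI qC) => ->; apply: eq_bigr => c _; apply: eq_bigr => x _.
  by congr (psi (_ * _))%R; rewrite mevalE big_tnth.
have p1 : 0 < p.-1 by rewrite -ltnS prednK ?prime_gt1 ?prime_gt0.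
have F1 : 0 < #|F|.-1 by rewrite -ltnS prednK ?finNzRing_gt1 // ltnW // finNzRing_gt1.
(* The pi-adic bound carries a factor p - 1 on both sides; cancelling it leaves the p-adic bound. *)
rewrite -NS in dS; have := pi_dvd_nat ker pF zP rz N0 dS.
rewrite pfactor_dvdn // !ceil_div_leq // [X in _ <= X -> _]mulnCA leq_pmul2l //.
by rewrite !mulnA.
Qed.
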